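(* Let $G$ be a complex linear algebraic group, let $W$ and $V$ be finite-dimensional complex representations of $G$, with $\rho\colon G\to\mathrm{GL}(V)$ the representation on $V$, and let $f\colon W\to V$ be a $G$-equivariant algebraic morphism (a $G$-equivariant polynomial map). For any $w\in W$ and $g\in G$, we have \[ \mathrm{im}(D_wf)\geq\rho(g^{-1})\cdot\mathrm{im}(D_g\rho)\cdot f(w) \quad\text{and}\quad \dim\mathrm{im}(D_wf)\geq\dim(\rho(G)\cdot f(w)). \]
   Context: $D_wf\colon W\to V$ is the derivative of $f$ at $w$. $D_g\rho\colon T_gG\to\mathfrak{gl}(V)=\mathrm{End}(V)$ is the derivative of $\rho$ at $g$ (with $\mathrm{GL}(V)$ viewed as an open subset of $\mathrm{End}(V)$), and $\mathrm{im}(D_g\rho)\cdot f(w)=\{A f(w)\mid A\in\mathrm{im}(D_g\rho)\}\leq V$. The symbol $\geq$ between subspaces denotes containment. $\rho(G)\cdot f(w)$ is the $G$-orbit of $f(w)$ in $V$, and its dimension is its dimension as an algebraic variety. Representations of linear algebraic groups are algebraic. *)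

(* Defs.v *)
From HB Require Import structures.
From mathcomp Require Import all_boot all_order all_algebra.
(* mpoly must be imported before the files that follow: in the other order the
   declarations of its notations at level 2 are rejected. *)
From mathcomp Require Import complex mpoly.
From mathcomp Require Import classical_sets reals constructive_ereal ereal.

Set Implicit Arguments.
Unset Strict Implicit.
Unset Printing Implicit Defensive.

Import Order.TTheory GRing.Theory Num.Theory.
Local Open Scope classical_set_scope.
Local Open Scope ring_scope.

(* The field of complex numbers is R[i], for R : realType. *)

Section AffineSpace.
Variables (R : realType) (E : vectType R[i]).

Definition coords (x : E) (i : 'I_(\dim {:E})) : R[i] :=
  coord (vbasis {:E}) i x.

Definition of_coords (c : 'I_(\dim {:E}) -> R[i]) : E :=
  \sum_i c i *: (vbasis {:E})`_i.

(* Polynomials on E, in the coordinates of a basis; every notion defined from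
   them below is independent of this basis. *)
Definition polyfun := {mpoly R[i][\dim {:E}]}.

Definition peval (p : polyfun) (x : E) : R[i] := p.@[coords x].

Definition zariski_closed (Z : set E) : Prop :=
  exists S : set polyfun, Z = [set x | forall p, S p -> peval p x = 0].

Definition irreducible (Z : set E) : Prop :=
  Z !=set0 /\
  forall A B : set E, zariski_closed A -> zariski_closed B ->
    Z `<=` A `|` B -> Z `<=` A \/ Z `<=` B.

(* Z 0 < Z 1 < ... < Z n, all irreducible and closed in the subspace X. *)
Definition irreducible_chain (X : set E) (n : nat) (Z : nat -> set E) : Prop :=
  (forall i, (i <= n)%N ->
     irreducible (Z i) /\ exists2 A, zariski_closed A & Z i = X `&` A) /\
  (forall i, (i < n)%N -> Z i `<` Z i.+1).

(* The dimension of X as a topological space, for the topology induced by the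
   Zariski topology of E. It is -oo for the empty set. *)
Definition zariski_dim (X : set E) : \bar R :=
  ereal_sup [set n%:R%:E | n in [set n | exists Z, irreducible_chain X n Z]].

End AffineSpace.

Section PolynomialMap.
Variables (R : realType) (W V : vectType R[i]).

(* R[i] being infinite, a polynomial map W -> V is the same as the tuple of its
   coordinate polynomials. *)
Record polymap := PolyMap { pcomp : 'I_(\dim {:V}) -> polyfun W }.

Definition pmap_fun (f : polymap) (w : W) : V :=
  of_coords (fun i => peval (pcomp f i) w).

Definition jacobian_map (f : polymap) (w u : W) : V :=
  of_coords (fun i => \sum_j peval (pcomp f i)^`M(j) w * coords u j).

Fact jacobian_map_is_linear f w : linear (jacobian_map f w).
Proof.
move=> a u v; rewrite /jacobian_map /of_coords scaler_sumr -big_split /=.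
apply: eq_bigr => i _; rewrite scalerA -scalerDl; congr (_ *: _).
rewrite mulr_sumr -big_split /=; apply: eq_bigr => j _.
by rewrite /coords linearP /= mulrDr mulrCA.
Qed.

HB.instance Definition _ f w :=
  GRing.isLinear.Build R[i] W V _ (jacobian_map f w) (jacobian_map_is_linear f w).

Definition derivative (f : polymap) (w : W) : 'Hom(W, V) :=
  linfun (jacobian_map f w).

End PolynomialMap.

Coercion pmap_fun : polymap >-> Funclass.

Section AlgebraicGroup.
Variables (R : realType) (m : nat).

(* G is a Zariski closed subgroup of GL_m. *)
Record linear_algebraic_group (G : set 'M[R[i]]_m) : Prop := {
  lag_unit : forall g, G g -> g \in unitmx;
  lag_one : G 1%:M;
  lag_mul : forall g h, G g -> G h -> G (g *m h);
  lag_inv : forall g, G g -> G (invmx g);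
  lag_closed : exists2 Z, zariski_closed Z & G = [set g | g \in unitmx] `&` Z
}.

Variable G : set 'M[R[i]]_m.

(* The coordinate ring of GL_m is generated by the entries and 1 / det. *)
Definition regular (a : 'M[R[i]]_m -> R[i]) : Prop :=
  exists (p : polyfun 'M[R[i]]_m) (e : nat),
    forall g, G g -> a g = peval p g / \det g ^+ e.

Definition regular_map (E : vectType R[i]) (phi : 'M[R[i]]_m -> E) : Prop :=
  forall i, regular (fun g => coords (phi g) i).

(* The invertibility of rho g, for g in G, follows from the first two fields. *)
Record algebraic_representation (V : vectType R[i])
    (rho : 'M[R[i]]_m -> 'End(V)) : Prop := {
  rep_one : rho 1%:M = \1%VF;
  rep_mul : forall g h, G g -> G h -> rho (g *m h) = (rho g \o rho h)%VF;
  rep_regular : regular_map rho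
}.

(* Elements of T_g G, as derivations at g of the ring of regular functions
   of G. The functions are total on matrices, so that delta must not depend on
   their values outside G. *)
Record tangent_vector (g : 'M[R[i]]_m)
    (delta : ('M[R[i]]_m -> R[i]) -> R[i]) : Prop := {
  tangent_ext : forall a b, regular a -> regular b ->
    (forall h, G h -> a h = b h) -> delta a = delta b;
  tangent_linear : forall c a b, regular a -> regular b ->
    delta (fun h => c * a h + b h) = c * delta a + delta b;
  tangent_leibniz : forall a b, regular a -> regular b ->
    delta (fun h => a h * b h) = delta a * b g + a g * delta b
}.

(* The differential of phi : G -> E along delta, where the tangent space of E
   at phi g is identified with E. *)
Definition differential (E : vectType R[i]) (phi : 'M[R[i]]_m -> E)
    (delta : ('M[R[i]]_m -> R[i]) -> R[i]) : E :=
  of_coords (fun i => delta (fun h => coords (phi h) i)).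

Definition im_differential (E : vectType R[i]) (phi : 'M[R[i]]_m -> E)
    (g : 'M[R[i]]_m) : set E :=
  [set differential phi delta | delta in tangent_vector g].

End AlgebraicGroup.

(* Main.v *)
Require Import Defs.
From HB Require Import structures.
From mathcomp Require Import all_boot all_order all_algebra.
From mathcomp Require Import perm complex mpoly ring.
From mathcomp Require Import boolp classical_sets functions filter reals constructive_ereal ereal.

(** The inclusion is the chain rule: since rho h (f w) = f (sigma h w) on G,
    differentiating along a tangent vector at g puts im(D_g rho) (f w) in the
    image of the derivative of f at sigma g w, and equivariance carries that
    image back to the one at w.

    For the dimensions, a chain Z_0 < ... < Z_n of irreducible closed subsets
    of the orbit yields polynomials p_1, ..., p_n that are algebraically
    independent on Z_n: p_k vanishes on Z_(k-1) but not on Z_k.  Their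
    pullbacks by f are independent on the orbit of w.  In characteristic 0 this
    forces their Jacobian to have rank n at some point of that orbit (extend the
    derivations d/dp_k to the coordinate functions), so that f has rank at least
    n there, hence also at w. *)

Set Implicit Arguments.
Unset Strict Implicit.
Unset Printing Implicit Defensive.

Import Order.TTheory GRing.Theory Num.Theory.
Local Open Scope classical_set_scope.
Local Open Scope ring_scope.

(** * Extension of derivations modulo a maximal ideal, in characteristic 0 *)

Definition leibniz (A L : pzRingType) (phi D : A -> L) : Prop :=
  forall a b, D (a * b) = phi a * D b + D a * phi b.

(* The quotient by I is never formed: vanishing modulo I is expressed by I. *)
Record maximal_ideal (L : comNzRingType) (I : L -> Prop) : Prop := {
  ideal0 : I 0;
  idealD : forall x y, I x -> I y -> I (x + y);
  idealM : forall x y, I y -> I (x * y);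
  ideal1 : ~ I 1;
  ideal_inv : forall x, ~ I x -> exists y, I (x * y - 1)
}.

Section MaximalIdeal.
Variables (L : comNzRingType) (I : L -> Prop) (hI : maximal_ideal I).

Lemma idealN x : I x -> I (- x).
Proof. by move=> Ix; rewrite -mulN1r; apply: idealM. Qed.

Lemma idealB x y : I x -> I y -> I (x - y).
Proof. by move=> Ix Iy; apply: idealD => //; apply: idealN. Qed.

Lemma idealMr x y : I x -> I (x * y).
Proof. by move=> Ix; rewrite mulrC; apply: idealM. Qed.

Lemma ideal_prime x y : I (x * y) -> ~ I x -> I y.
Proof.
move=> Ixy /(ideal_inv hI)[z Iz].
have -> : y = z * (x * y) - y * (x * z - 1) by ring.
by apply: idealB; apply: idealM.
Qed.

Lemma ideal_primeX x n : I (x ^+ n) -> I x.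
Proof.
elim: n => [|n IHn]; first by rewrite expr0 => /(ideal1 hI).
rewrite exprS => Ix; apply: contrapT => nIx.
exact: nIx (IHn (ideal_prime Ix nIx)).
Qed.

Lemma ideal_sum (J : Type) (r : seq J) (P : pred J) (F : J -> L) :
  (forall j, I (F j)) -> I (\sum_(j <- r | P j) F j).
Proof.
by move=> IF; elim/big_ind: _ => //; [apply: ideal0|apply: idealD].
Qed.

End MaximalIdeal.

Section ExtendDerivation.
Variables (A L : comNzRingType) (phi : {rmorphism A -> L}).
Variable D : {additive A -> L}.
Hypothesis leibD : leibniz phi D.
Variable y : L.

Definition poly_eval (p : {poly A}) : L := (map_poly phi p).[y].

Fact poly_eval_is_zmod_morphism : zmod_morphism poly_eval.
Proof. by move=> p q; rewrite /poly_eval rmorphB /= !hornerE. Qed.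
Fact poly_eval_is_monoid_morphism : monoid_morphism poly_eval.
Proof.
by split=> [|p q]; rewrite /poly_eval ?rmorph1 ?rmorphM /= !hornerE.
Qed.
HB.instance Definition _ :=
  GRing.isZmodMorphism.Build _ _ poly_eval poly_eval_is_zmod_morphism.
HB.instance Definition _ :=
  GRing.isMonoidMorphism.Build _ _ poly_eval poly_eval_is_monoid_morphism.

Lemma poly_evalC a : poly_eval a%:P = phi a.
Proof. by rewrite /poly_eval map_polyC hornerC. Qed.

Lemma poly_evalX : poly_eval 'X = y.
Proof. by rewrite /poly_eval map_polyX hornerX. Qed.

(** The derivation of [{poly A}] along evaluation at [y] that extends [D] and takes the value [c] at
    ['X]. *)
Definition poly_derive (c : L) (p : {poly A}) : L :=
  (map_poly D p).[y] + c * poly_eval p^`().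

Fact poly_derive_is_zmod_morphism c : zmod_morphism (poly_derive c).
Proof.
move=> p q; rewrite /poly_derive derivB !raddfB /= !hornerE; ring.
Qed.
HB.instance Definition _ c := GRing.isZmodMorphism.Build _ _ (poly_derive c)
  (poly_derive_is_zmod_morphism c).

Lemma poly_deriveC c a : poly_derive c a%:P = D a.
Proof. by rewrite /poly_derive map_polyC derivC raddf0 hornerC mulr0 addr0. Qed.

Lemma poly_deriveX c : poly_derive c 'X = c.
Proof.
have D1 : D 1 = 0.
  apply: (addrI (D 1)); rewrite addr0.
  by have := leibD 1 1; rewrite rmorph1 !(mul1r, mulr1).
rewrite /poly_derive derivX rmorph1 mulr1.
suff -> : map_poly D 'X = 0 by rewrite horner0 add0r.
apply/polyP => i; rewrite coef_map coefX coef0.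
by case: (i == 1)%N; rewrite ?D1 ?raddf0.
Qed.

Let coefDM a p : map_poly D (a *: p) = phi a *: map_poly D p + D a *: map_poly phi p.
Proof. by apply/polyP => i; rewrite coefD !coefZ !coef_map /= coefZ leibD. Qed.

Let mapDX p : map_poly D (p * 'X) = map_poly D p * 'X.
Proof.
apply/polyP => i; rewrite coef_map !coefMX coef_map.
by case: eqP => // _; rewrite raddf0.
Qed.

Lemma leibniz_poly_derive c : leibniz poly_eval (poly_derive c).
Proof.
have mulX p : poly_derive c (p * 'X)
    = poly_eval p * poly_derive c 'X + poly_derive c p * poly_eval 'X.
  rewrite poly_deriveX poly_evalX /poly_derive mapDX hornerMX derivM derivX.
  rewrite mulr1 raddfD /= !rmorphM /= poly_evalX; ring.
have mulC a p : poly_derive c (a%:P * p)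
    = poly_eval a%:P * poly_derive c p + poly_derive c a%:P * poly_eval p.
  rewrite poly_deriveC poly_evalC /poly_derive mul_polyC coefDM derivZ.
  rewrite hornerD !hornerZ -[a *: _]mul_polyC rmorphM /= poly_evalC.
  rewrite -/(poly_eval p); ring.
move=> p q; elim/poly_ind: p q => [|p a IHp] q.
  by rewrite mul0r !raddf0 !mul0r addr0.
rewrite mulrDl !raddfD /= mulC !rmorphM /= -mulrA IHp [_ * q]mulrC !mulX.
rewrite rmorphM /=; ring.
Qed.

Variables (I : L -> Prop) (hI : maximal_ideal I).
Hypothesis char0 : forall n, ~ I n.+1%:R.
Hypothesis kerD : forall a, I (phi a) -> I (D a).

Let coefs_in (p : {poly A}) : (forall i, I (phi p`_i)) -> forall c, I (poly_derive c p).
Proof.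
move=> Ip c; rewrite /poly_derive; apply: (idealD hI).
  rewrite horner_coef; apply: (ideal_sum hI) => i; apply: (idealMr hI).
  by rewrite coef_map; apply: kerD.
apply: (idealM hI); rewrite /poly_eval horner_coef; apply: (ideal_sum hI) => i.
apply: (idealMr hI); rewrite coef_map coef_deriv raddfMn /= -mulr_natl.
exact: (idealM hI).
Qed.

(* If y is transcendental modulo I, any c will do; otherwise c is dictated by an
   equation p of minimal degree, and pseudo-division by p reduces every other
   equation to p. *)
Lemma extend_derivation :
  exists c, forall p, I (poly_eval p) -> I (poly_derive c p).
Proof.
(* Equations of [y] whose coefficients all map into [I] are trivial modulo [I] and do not count;
   [coefs_in] settles them for every [c]. *)
pose alg n := `[< exists p : {poly A}, [/\ size p = n, I (poly_eval p)
                            & exists i, ~ I (phi p`_i)] >].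
have [exn|nex] := EM (exists n, alg n); last first.
  exists 0 => p Ip; apply: coefs_in => i; apply: contrapT => nI.
  by apply: nex; exists (size p); apply/asboolP; exists p; split => //; exists i.
case: (ex_minnP exn) => n /asboolP[p [szp Ip [i nIi]]] min_n.
have small (q : {poly A}) : (size q < n)%N -> I (poly_eval q) -> forall i, I (phi q`_i).
  move=> ltq Iq k; apply: contrapT => nI.
  suff /min_n : alg (size q) by rewrite leqNgt ltq.
  by apply/asboolP; exists q; split => //; exists k.
have p0 : p != 0 by apply: contra_notN nIi => /eqP->; rewrite coef0 raddf0; apply: (ideal0 hI).
(* Otherwise dropping the leading term would leave a shorter equation, still nontrivial because its
   coefficients agree with those of [p] modulo [I]. *)
have nlead : ~ I (phi (lead_coef p)).
  move=> Il; pose q := p - lead_coef p *: 'X^(n.-1).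
  have szq : (size q < n)%N.
    rewrite -szp -(prednK (n := size p)) ?size_poly_gt0 // ltnS.
    apply/leq_sizeP => j lej; rewrite coefB coefZ coefXn -szp.
    move: lej; rewrite leq_eqVlt => /orP[/eqP<-|ltj].
      by rewrite eqxx mulr1 subrr.
    rewrite (gtn_eqF ltj) mulr0 subr0 nth_default //.
    by rewrite -(prednK (n := size p)) ?size_poly_gt0.
  have Iq : I (poly_eval q).
    rewrite raddfB /=; apply: (idealB hI) => //.
    by rewrite -mul_polyC rmorphM /= poly_evalC; apply: (idealMr hI).
  have := small q szq Iq i; rewrite coefB coefZ raddfB /= rmorphM /= => Ii.
  apply: nIi; have := idealD hI Ii (idealMr hI (phi 'X^(n.-1)`_i) Il).
  by rewrite subrK.
have szpgt1 : (1 < n)%N.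
  rewrite -szp ltnNge; apply/negP => /size1_polyC pE; apply: nlead.
  by rewrite pE lead_coefC; rewrite pE poly_evalC in Ip.
(* The derivative is shorter than [p], so by minimality its coefficient of index [n.-2], which is
   [n.-1] times the leading coefficient of [p], would map into [I]; characteristic 0 excludes
   this. *)
have nder : ~ I (poly_eval p^`()).
  move=> Id; have szd : (size p^`() < n)%N by rewrite -szp lt_size_deriv.
  have := small _ szd Id n.-2; rewrite coef_deriv rmorphMn /= -mulr_natl => Il.
  apply: nlead; rewrite /lead_coef szp.
  by move: Il szpgt1; case: (n) => [//|[//|k]] /= Il _; apply: ideal_prime Il _.
have [z Iz] := ideal_inv hI nder.
(* This [c] solves D(p)(y) + c p'(y) = 0 modulo [I], [z] being an inverse of p'(y). *)
exists (- (map_poly D p).[y] * z) => q Iq.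
set c := _ * z.
have Ipc : I (poly_derive c p).
  rewrite /poly_derive /c; set u := _.[y]; set v := poly_eval _ in Iz *.
  have -> : u + - u * z * v = - u * (v * z - 1) by ring.
  exact: (idealM hI).
(* Pseudo-division gives [a *: q = b * p + r], with [a] a power of the leading coefficient of [p].
   The remainder is shorter than [p], so its coefficients vanish modulo [I]. The Leibniz rule then
   transfers the claim from [p] to [a *: q], and [a] cancels because [I] is prime. *)
set r := Pdiv.Ring.rmodp q p.
have /(congr1 (fun s => s - r)) := Pdiv.ComRing.rdivp_eq p q.
rewrite -/r addrK; set a := _ ^+ _; set b := Pdiv.Ring.rdivp q p => eqr.
have Ir : I (poly_eval r).
  have -> : r = a *: q - b * p by rewrite -eqr opprB addrC subrK.
  rewrite raddfB /= -mul_polyC !rmorphM /=.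
  by apply: (idealB hI); apply: (idealM hI).
have ltr : (size r < n)%N by rewrite -szp Pdiv.Ring.ltn_rmodp.
have Idr := coefs_in (small r ltr Ir) c.
have : I (poly_derive c (a *: q)).
  have -> : a *: q = b * p + r by rewrite -eqr subrK.
  rewrite raddfD /= leibniz_poly_derive.
  apply: (idealD hI) => //; apply: (idealD hI); exact: (idealM hI).
rewrite -mul_polyC leibniz_poly_derive poly_evalC => Ia.
have := idealB hI Ia (idealM hI (poly_derive c a%:P) Iq).
rewrite addrK => /(ideal_prime hI); apply; rewrite rmorphXn.
by move/(ideal_primeX hI).
Qed.

End ExtendDerivation.

(** Iterates [extend_derivation]: [B] adjoins to [A] one indeterminate per element of [s], which
    [psi] sends to that element. Relations between these elements enter only through the condition
    that [E] respects vanishing modulo [I]. *)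
Lemma extend_derivation_seq (A L : comNzRingType) (phi : {rmorphism A -> L})
    (D : {additive A -> L}) (I : L -> Prop) (s : seq L) :
  maximal_ideal I -> (forall n, ~ I n.+1%:R) ->
  leibniz phi D -> (forall a, I (phi a) -> I (D a)) ->
  exists (B : comNzRingType) (iota : {rmorphism A -> B})
         (psi : {rmorphism B -> L}) (E : {additive B -> L}),
    [/\ leibniz psi E, forall b, I (psi b) -> I (E b),
        forall a, psi (iota a) = phi a, forall a, E (iota a) = D a
      & forall x, x \in s -> exists b, psi b = x].
Proof.
move=> hI char0; elim: s A phi D => [|y s IHs] A phi D leibD kerD.
  by exists A, idfun, phi, D; split.
have [c kerc] := extend_derivation leibD y hI char0 kerD.
have [B [iota [psi [E [lE kE psiE EE surj]]]]] :=
  IHs _ (poly_eval phi y) (poly_derive phi D y c) (leibniz_poly_derive leibD y c) kerc.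
exists B, (iota \o polyC), psi, E; split => //= [a|a|x].
- by rewrite psiE; apply: poly_evalC.
- by rewrite EE; apply: poly_deriveC.
rewrite inE => /orP[/eqP->|/surj//].
by exists (iota 'X); rewrite psiE; apply: poly_evalX.
Qed.

(** * Morphisms and derivations of polynomial rings in several variables *)

Lemma mpoly_ring_ind (K : comNzRingType) (n : nat) (P : {mpoly K[n]} -> Prop) :
  (forall c, P c%:MP) -> (forall i, P 'X_i) ->
  (forall p q, P p -> P q -> P (p + q)) ->
  (forall p q, P p -> P q -> P (p * q)) -> forall p, P p.
Proof.
move=> PC PX PD PM; elim/mpolyind => [|c m p _ _ Pp]; first exact: (PC 0).
apply: PD => //; rewrite -mul_mpolyC; apply: (PM) => //.
rewrite mpolyXE_id; elim/big_ind: _ => //; first exact: (PC 1).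
by move=> i _; elim: (m i) => [|k IHk]; [exact: (PC 1)|rewrite exprS; apply: PM].
Qed.

Lemma eq_rmorphism_mpoly (K L : comNzRingType) (n : nat)
    (f g : {rmorphism {mpoly K[n]} -> L}) :
  (forall c, f c%:MP = g c%:MP) -> (forall i, f 'X_i = g 'X_i) -> f =1 g.
Proof.
move=> eqC eqX; elim/mpoly_ring_ind => // p q eqp eqq.
  by rewrite !rmorphD eqp eqq.
by rewrite !rmorphM eqp eqq.
Qed.

(** The common source of the chain rules below: for extended derivations, derivatives along a line,
    tangent vectors and pullbacks of polynomials. *)
Lemma derivation_mpoly (K L : comNzRingType) (n : nat)
    (f : {rmorphism {mpoly K[n]} -> L}) (D : {mpoly K[n]} -> L) :
  {morph D : p q / p + q} -> leibniz f D -> (forall c, D c%:MP = 0) ->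
  forall p, D p = \sum_i f p^`M(i) * D 'X_i.
Proof.
move=> addD leibD DC; elim/mpoly_ring_ind => [c|k|p q Dp Dq|p q Dp Dq].
- by rewrite DC big1 // => i _; rewrite mderivC rmorph0 mul0r.
- rewrite (bigD1 k) //= big1 ?addr0 => [|i neik].
    have -> : 'X_k^`M(k) = 1 :> {mpoly K[n]}.
      rewrite mderivX mnm1E eqxx scale1r -mpolyX0; congr 'X_[_].
      by apply/mnmP => l; rewrite mnmBE subnn mnm0E.
    by rewrite rmorph1 mul1r.
  by rewrite mderivX mnm1E eq_sym (negPf neik) scale0r rmorph0 mul0r.
- rewrite addD Dp Dq -big_split; apply: eq_bigr => i _ /=.
  by rewrite mderivD rmorphD mulrDl.
rewrite leibD Dp Dq mulr_sumr mulr_suml -big_split; apply: eq_bigr => i _ /=.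
by rewrite mderivM rmorphD !rmorphM /=; ring.
Qed.

(** * Functions modulo an ultrafilter and the Jacobian criterion *)

Section FunctionEvaluation.
Variables (K : comNzRingType) (T : pointedType) (n : nat) (x : T -> 'I_n -> K).

Definition fun_meval (p : {mpoly K[n]}) : T -> K := fun t => p.@[x t].

Fact fun_meval_is_zmod_morphism : zmod_morphism fun_meval.
Proof. by move=> p q; apply/funext => t; rewrite /fun_meval mevalB. Qed.
Fact fun_meval_is_monoid_morphism : monoid_morphism fun_meval.
Proof.
by split=> [|p q]; apply/funext => t; rewrite /fun_meval ?meval1 ?mevalM.
Qed.
HB.instance Definition _ :=
  GRing.isZmodMorphism.Build _ _ fun_meval fun_meval_is_zmod_morphism.
HB.instance Definition _ :=
  GRing.isMonoidMorphism.Build _ _ fun_meval fun_meval_is_monoid_morphism.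

End FunctionEvaluation.

(** The quotient is the ultrapower of [K] along [U]. It is a field because an ultrafilter contains
    the complement of each set that it omits, so that pointwise inversion works on a member of
    [U]. *)
Lemma ultrafilter_maximal_ideal (K : fieldType) (T : pointedType)
    (U : set_system T) :
  UltraFilter U -> maximal_ideal (fun f : T -> K => U [set t | f t = 0]).
Proof.
move=> ultraU; split => /=.
- by apply: filterS filterT => t _.
- move=> f g; apply: filterS2 => t /= ft gt.
  by have -> : (f + g) t = f t + g t by []; rewrite ft gt addr0.
- move=> f g; apply: filterS => t /= gt.
  by have -> : (f * g) t = f t * g t by []; rewrite gt mulr0.
- move=> U1; have [t /eqP] := filter_ex U1.
  by have -> : (1 : T -> K) t = 1 by []; rewrite oner_eq0.
move=> f nUf; exists (fun t => (f t)^-1).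
have [//|] := in_ultra_setVsetC [set t | f t = 0] ultraU.
apply: filterS => t /= /eqP ft.
by have -> : (f * (fun t => (f t)^-1) - 1) t = f t * (f t)^-1 - 1 by [];
   rewrite divff // subrr.
Qed.

Section JacobianCriterion.
Variables (K : numFieldType) (T : pointedType) (S : set T) (d n : nat).
Variables (x : T -> 'I_d -> K) (q : 'I_n -> {mpoly K[d]}).
Let u (t : T) (i : 'I_n) : K := (q i).@[x t].
Hypothesis indep : forall F, (forall t, S t -> F.@[u t] = 0) -> F = 0.

(** Plays the role of the generic point: the basic sets are preimages in [S], under [u], of nonempty
    principal open sets of affine [n]-space. Independence makes them nonempty, and products of
    polynomials give intersections. *)
Let generic : set_system T :=
  [set A | exists2 F, F != 0 & forall t, S t -> F.@[u t] != 0 -> A t].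

Let generic_proper : ProperFilter generic.
Proof.
split.
  case=> F /eqP F0 Fu; apply: F0; apply: indep => t St.
  by apply/eqP; apply: contrapT => /negP /(Fu t St).
split.
- by exists 1 => //; apply: oner_neq0.
- move=> A B [F F0 FA] [H H0 HB]; exists (F * H); first exact: mulf_neq0.
  move=> t St; rewrite mevalM mulf_eq0 negb_or => /andP[Ft Ht].
  by split; [apply: FA|apply: HB].
- by move=> A B sAB [F F0 FA]; exists F => // t St Ft; apply/sAB/FA.
Qed.

(* The derivations F(q) |-> (dF/dX_k)(q) extend, modulo an ultrafilter containing all
   generic sets, to the coordinate functions; the values of the extensions at
   the coordinates are the columns of the right inverse C. *)
Lemma jacobian_criterion :
  exists2 t, S t & exists C : 'M[K]_(d, n),
    (\matrix_(i < n, j < d) (q i)^`M(j).@[x t]) *m C = 1%:M.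
Proof.
have [U [ultraU genU]] := ultraFilterLemma generic_proper.
have hI := ultrafilter_maximal_ideal K ultraU; set I := fun f => _ in hI.
have char0 k : ~ I k.+1%:R.
  have E t : (k.+1%:R : T -> K) t = k.+1%:R.
    by elim: (k.+1) => // l IH; rewrite !mulrSr -IH.
  by move=> Ik; have [t /eqP] := filter_ex Ik; rewrite E pnatr_eq0.
(* Evaluation at the [q i] is thus injective modulo [I], which gives every derivation of the
   polynomial ring the kernel condition needed to extend it. *)
have kerE F : I (fun_meval u F) -> F = 0.
  move=> IF; apply: contrapT => /eqP F0.
  have UF : U [set t | F.@[u t] != 0] by apply: genU; exists F.
  by have [t [/= Ft /eqP nFt]] := filter_ex (filterI IF UF); apply: nFt.
have column k : exists c : 'I_d -> T -> K, forall i, U [set t |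
    (i == k)%:R = \sum_j (q i)^`M(j).@[x t] * c j t].
  pose D := fun_meval u \o mderiv k.
  have leibD : leibniz (fun_meval u) D.
    by move=> F H; rewrite /D /= mderivM rmorphD !rmorphM /= addrC.
  have kerD F : I (fun_meval u F) -> I (D F).
    by move=> /kerE ->; rewrite /D /= mderiv0 rmorph0; apply: ideal0.
  have [B [iota [psi [E [leibE kerpsi psiE EE surj]]]]] :=
    extend_derivation_seq [seq x^~ j | j <- enum 'I_d] hI char0 leibD kerD.
  have /fin_all_exists[b bE] (j : 'I_d) : exists b, psi b = x^~ j.
    by apply: surj; apply: map_f; rewrite mem_enum.
  exists (fun j => E (b j)) => i.
  pose h : {rmorphism K -> B} := iota \o @mpolyC n K.
  have hb p : psi (mmap h b p) = fun_meval x p.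
    apply: (@eq_rmorphism_mpoly _ _ _ (psi \o mmap h b) (fun_meval x)) => /=.
      move=> c; rewrite mmapC psiE; apply/funext => t.
      exact: etrans (mevalC _ _) (esym (mevalC _ _)).
    move=> j; rewrite mmapX mmap1U bE; apply/funext => t.
    by rewrite /fun_meval mevalXU.
  (* The function [q i] of the coordinates has two lifts to [B]: [iota 'X_i], and [q i] evaluated at
     the [b j]. Their difference maps to 0, so [E] agrees on them modulo [I]; computing both values
     gives the required equation. *)
  have := kerpsi (iota 'X_i - mmap h b (q i)).
  rewrite raddfB /= psiE hb.
  have -> : fun_meval u 'X_i - fun_meval x (q i) = 0.
    by apply/eqP; rewrite subr_eq0; apply/eqP/funext => t; rewrite /fun_meval mevalXU.
  move=> /(_ (ideal0 hI)); rewrite raddfB /= EE.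
  have -> : E (mmap h b (q i)) = \sum_j fun_meval x (q i)^`M(j) * E (b j).
    rewrite (@derivation_mpoly K _ d (fun_meval x) (fun p => E (mmap h b p))).
    - by apply: eq_bigr => j _; rewrite mmapX mmap1U.
    - by move=> p r; rewrite !raddfD.
    - by move=> p r; rewrite rmorphM leibE !hb.
    - by move=> c; rewrite mmapC EE /D /= mderivC rmorph0.
  apply: filterS => t /= /eqP.
  have -> f g : (f - g : T -> K) t = f t - g t by [].
  rewrite subr_eq0 fct_sumE => /eqP <-.
  rewrite /D /= /fun_meval mderivX mnm1E; have [->|neik] := eqVneq i k.
    have -> : (U_(k) - U_(k))%MM = 0%MM :> 'X_{1..n}.
      by apply/mnmP => l; rewrite mnmBE subnn mnm0E.
    by rewrite scale1r mpolyX0 meval1.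
  by rewrite scale0r meval0.
have [c cE] := choice column.
have US : U S by apply: genU; exists 1 => //; apply: oner_neq0.
(* There are finitely many pairs of indices, so all equations hold together at some point of [S]. *)
have Ueq : U [set t | forall ik : 'I_n * 'I_n, (ik.1 == ik.2)%:R
    = \sum_j (q ik.1)^`M(j).@[x t] * c ik.2 j t].
  by apply: filter_forall => ik; apply: cE.
have [t [St teq]] := filter_ex (filterI US Ueq).
exists t => //; exists (\matrix_(j, k) c k j t).
apply/matrixP => i k; rewrite !mxE (teq (i, k)).
by apply: eq_bigr => j _; rewrite !mxE.
Qed.

End JacobianCriterion.

(** * Algebraic independence along a chain of irreducible sets *)

Section SplitLastVariable.
Variables (K : comNzRingType) (k : nat).

Definition split_last : {rmorphism {mpoly K[k.+1]} -> {poly {mpoly K[k]}}} :=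
  mmap (polyC \o @mpolyC k K)
    (fun i => if unlift ord_max i is Some j then ('X_j)%:P else 'X).

Lemma split_lastC c : split_last c%:MP = (c%:MP)%:P.
Proof. exact: mmapC. Qed.

Lemma split_lastX i :
  split_last 'X_i = if unlift ord_max i is Some j then ('X_j)%:P else 'X.
Proof. by rewrite /= mmapX mmap1U. Qed.

Lemma split_last_inj F : split_last F = 0 -> F = 0.
Proof.
pose w : {rmorphism {mpoly K[k]} -> {mpoly K[k.+1]}} :=
  mmap (@mpolyC k.+1 K) (fun j => 'X_(lift ord_max j)).
pose join := horner_eval ('X_ord_max : {mpoly K[k.+1]}) \o map_poly w.
have joinK : join \o split_last =1 idfun.
  apply: eq_rmorphism_mpoly => [c|i].
    by rewrite /join /= split_lastC map_polyC /= horner_evalE hornerC mmapC.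
  rewrite /join /= split_lastX; case: unliftP => [j|] ->.
    by rewrite map_polyC /= horner_evalE hornerC mmapX mmap1U.
  by rewrite map_polyX horner_evalE hornerX.
by move=> F0; rewrite -[F]/(idfun F) -joinK /join /= F0 map_poly0 horner_evalE horner0.
Qed.

Lemma meval_split_last (v : 'I_k.+1 -> K) F :
  F.@[v] = (map_poly (meval (fun j => v (lift ord_max j))) (split_last F)).[v ord_max].
Proof.
pose f := horner_eval (v ord_max) \o
  map_poly (meval (fun j => v (lift ord_max j))) \o split_last.
apply: (@eq_rmorphism_mpoly _ _ _ (meval v) f) => [c|i]; rewrite /f /=.
  by rewrite mevalC split_lastC map_polyC horner_evalE hornerC /= mevalC.
rewrite mevalXU split_lastX; case: unliftP => [j|] ->.
  by rewrite map_polyC horner_evalE hornerC /= mevalXU.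
by rewrite map_polyX horner_evalE hornerX.
Qed.

End SplitLastVariable.

Lemma meval_mmap (K : comNzRingType) (k d : nat) (p : 'I_k -> {mpoly K[d]})
    (v : 'I_d -> K) (F : {mpoly K[k]}) :
  (mmap (@mpolyC d K) p F).@[v] = F.@[fun i => (p i).@[v]].
Proof.
apply: (@eq_rmorphism_mpoly _ _ _ (meval v \o mmap (@mpolyC d K) p)) => /= [c|i].
  by rewrite mmapC !mevalC.
by rewrite mmapX mmap1U mevalXU.
Qed.

Section AlgebraicIndependence.
Variables (R : realType) (V : vectType R[i]).

Definition independent_on (Z : set V) (k : nat) (p : 'I_k -> polyfun V) : Prop :=
  forall F, (forall z, Z z -> F.@[fun i => peval (p i) z] = 0) -> F = 0.

Lemma irreducible_vanish (Z : set V) (p q : polyfun V) : irreducible Z ->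
  (forall z, Z z -> peval (p * q) z = 0) ->
  (forall z, Z z -> peval p z = 0) \/ (forall z, Z z -> peval q z = 0).
Proof.
move=> [_ irr] pq0.
have closed r : zariski_closed [set x : V | peval r x = 0].
  by exists [set r]; apply/seteqP; split=> x /= => [? _ ->//|]; apply.
have [z Zz||] := irr _ _ (closed p) (closed q); [|by left|by right].
have /eqP := pq0 z Zz; rewrite /peval mevalM mulf_eq0.
by move=> /orP[]/eqP ?; [left|right].
Qed.

(** In a relation between the [p j] and [q] on [Z], the constant coefficient with respect to [q] is
    a relation between the [p j] on [Y], where [q] vanishes; so it is zero. The relation is then a
    multiple of [q], which cancels since [Z] is irreducible, and the degree in [q] drops. *)
Lemma independent_extend (Y Z : set V) (k : nat) (p : 'I_k -> polyfun V) q :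
  irreducible Z -> Y `<=` Z -> independent_on Y p ->
  (forall y, Y y -> peval q y = 0) -> ~ (forall z, Z z -> peval q z = 0) ->
  independent_on Z (fun i => if unlift ord_max i is Some j then p j else q).
Proof.
move=> irrZ sYZ indp qY qZ.
have vanish (P : {poly {mpoly R[i][k]}}) :
    (forall z, Z z ->
       (map_poly (meval (fun i => peval (p i) z)) P).[peval q z] = 0) -> P = 0.
  elim/poly_ind: P => // P c IHP Pz.
  have c0 : c = 0.
    apply: indp => y Yy; have := Pz y (sYZ _ Yy).
    rewrite rmorphD rmorphM /= map_polyX map_polyC /= hornerD hornerMX hornerC.
    by rewrite qY // mulr0 add0r.
  rewrite c0 addr0 [P]IHP ?mul0r // => z Zz; move: z Zz.
  pose H : polyfun V := (map_poly (mmap (@mpolyC _ _) p) P).[q].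
  have HE z : peval H z
      = (map_poly (meval (fun i => peval (p i) z)) P).[peval q z].
    rewrite /peval /H -horner_map -map_poly_comp; congr (_.[_]).
    by apply: eq_map_poly => F /=; rewrite meval_mmap.
  have [z Zz|H0|//] := irreducible_vanish irrZ (p := H) (q := q).
    rewrite /peval mevalM -!/(peval _ z) HE; have := Pz z Zz.
    by rewrite c0 addr0 rmorphM /= map_polyX hornerMX.
  by move=> z Zz; rewrite -HE; apply: H0.
move=> F F0; apply: split_last_inj; apply: vanish => z Zz.
rewrite -{}[RHS](F0 z Zz) meval_split_last unlift_none; congr (_.[_]).
by apply: eq_map_poly => H; apply: meval_eq => j; rewrite liftK.
Qed.

Lemma chain_independent (X : set V) (n : nat) (Z : nat -> set V) :
  irreducible_chain X n Z -> exists p : 'I_n -> polyfun V, independent_on (Z n) p.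
Proof.
move=> [irrZ ltZ].
suff indZ k : (k <= n)%N -> exists p : 'I_k -> polyfun V, independent_on (Z k) p.
  exact: indZ.
elim: k => [_|k IHk lekn].
  have [[[z Zz] _] _] := irrZ 0%N (leq0n n).
  exists (fun=> 0) => F /(_ z Zz).
  (* A polynomial in no variables is constant, so one point of [Z 0] suffices. *)
  suff [c ->] : exists c, F = c%:MP by rewrite mevalC => ->; apply: mpolyC0.
  elim/mpoly_ring_ind: F => [c|[]//|_ _ [a ->] [b ->]|_ _ [a ->] [b ->]].
  - by exists c.
  - by exists (a + b); rewrite mpolyCD.
  - by exists (a * b); rewrite mpolyCM.
have [p indp] := IHk (ltnW lekn).
have [sZ nsZ] := ltZ k lekn.
have [_ [A [Q ->] ZkE]] := irrZ k (ltnW lekn).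
have [irrZ1 [B _ Zk1E]] := irrZ k.+1 lekn.
(* [Z k] is cut out in [X] by [Q]; if all of [Q] vanished on [Z k.+1], that set would lie in [Z k],
   against strictness of the chain. *)
have [q Qq nq] : exists2 q, Q q & ~ (forall z, Z k.+1 z -> peval q z = 0).
  apply: contrapT => nex; apply: nsZ => z Zz; rewrite ZkE; split.
    by move: Zz; rewrite Zk1E => -[].
  move=> q Qq; apply: contrapT => qz; apply: nex; exists q => //.
  by move=> /(_ z Zz).
exists (fun i => if unlift ord_max i is Some j then p j else q).
apply: independent_extend indp _ nq => // y.
by rewrite ZkE => -[_]; apply.
Qed.

End AlgebraicIndependence.

(** * Coordinates and the derivative of an equivariant map *)

Section Coordinates.
Variables (R : realType) (E : vectType R[i]).

Lemma coords_of_coords c (i : 'I_(\dim {:E})) : coords (of_coords c) i = c i.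
Proof. exact: coord_sum_free (basis_free (vbasisP _)). Qed.

Lemma of_coordsK (x : E) : of_coords (coords x) = x.
Proof. exact: esym (coord_vbasis (memvf x)). Qed.

Lemma coords_inj (x y : E) : coords x =1 coords y -> x = y.
Proof.
move=> eqxy; rewrite -[x]of_coordsK -[y]of_coordsK.
by apply: eq_bigr => i _; rewrite eqxy.
Qed.

Lemma coords_sum (J : Type) (r : seq J) (P : pred J) (F : J -> E) i :
  coords (\sum_(j <- r | P j) F j) i = \sum_(j <- r | P j) coords (F j) i.
Proof. by rewrite /coords linear_sum. Qed.

Lemma coordsZ a (x : E) i : coords (a *: x) i = a * coords x i.
Proof. by rewrite /coords linearZ. Qed.

Lemma coordsD (x y : E) i : coords (x + y) i = coords x i + coords y i.
Proof. by rewrite /coords linearD. Qed.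

Lemma linear_of_coords (F : lmodType R[i]) (h : {linear E -> F}) x :
  h x = \sum_k coords x k *: h (vbasis {:E})`_k.
Proof.
rewrite -{1}[x]of_coordsK linear_sum; apply: eq_bigr => k _.
by rewrite linearZ.
Qed.

End Coordinates.

Lemma horner0_eq0 (K : numFieldType) (p : {poly K}) :
  (forall t, p.[t] = 0) -> p = 0.
Proof.
move=> p0; apply: contrapT => /eqP pn0.
have roots_p (rs : seq K) : all (root p) rs by apply/allP => t _; apply/rootP.
have := max_poly_roots pn0 (roots_p [seq i%:R | i <- iota 0 (size p)]).
rewrite size_map size_iota ltnn; suff -> : uniq [seq i%:R : K | i <- iota 0 (size p)].
  by move=> /(_ isT).
by rewrite map_inj_uniq ?iota_uniq //; apply: mulrIn; apply: oner_neq0.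
Qed.

Section Equivariance.
Variables (R : realType) (W V : vectType R[i]).

(** The polynomial p(x + t b) in t, whose derivative at 0 is the directional derivative of p at [x]
    along [b]. *)
Definition restrict_line (x b : W) : {rmorphism polyfun W -> {poly R[i]}} :=
  mmap polyC (fun j => (coords x j)%:P + (coords b j)%:P * 'X).

Lemma horner_restrict_line x b p t :
  (restrict_line x b p).[t] = peval p (x + t *: b).
Proof.
apply: (@eq_rmorphism_mpoly _ _ _ (horner_eval t \o restrict_line x b)
          (meval (coords (x + t *: b)))) => [c|j] /=; rewrite horner_evalE.
  by rewrite mmapC mevalC hornerC.
by rewrite mmapX mmap1U mevalXU coordsD coordsZ !hornerE mulrC.
Qed.

Lemma deriv_restrict_line x b p :
  (restrict_line x b p)^`().[0] = \sum_j peval p^`M(j) x * coords b j.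
Proof.
rewrite (@derivation_mpoly _ _ _ (meval (coords x))
           (fun p => (restrict_line x b p)^`().[0])).
- apply: eq_bigr => j _; congr (_ * _).
  by rewrite /= mmapX mmap1U !derivE !hornerE.
- by move=> q r; rewrite rmorphD derivD hornerD.
- move=> q r; rewrite rmorphM derivM hornerD !hornerM !horner_restrict_line.
  by rewrite scale0r addr0 addrC.
- by move=> c; rewrite /= mmapC derivC horner0.
Qed.

Variable f : polymap W V.

Lemma coords_polymap w i : coords (f w) i = peval (Defs.pcomp f i) w.
Proof. exact: coords_of_coords. Qed.

Lemma coords_jacobian_map w u i :
  coords (jacobian_map f w u) i = \sum_j peval (Defs.pcomp f i)^`M(j) w * coords u j.
Proof. exact: coords_of_coords. Qed.

(** Differentiates f(M(x + t b)) = N(f(x + t b)) at t = 0. The identity holds at every value of t,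
    hence between polynomials in t, as the field is infinite. *)
Lemma equivariant_jacobian_map (M : 'End(W)) (N : 'End(V)) :
  (forall x, f (M x) = N (f x)) ->
  forall x b, jacobian_map f (M x) (M b) = N (jacobian_map f x b).
Proof.
move=> fMN x b; apply: coords_inj => i.
rewrite coords_jacobian_map -deriv_restrict_line.
pose N_ k := coords (N (vbasis {:V})`_k) i.
have NE v : coords (N v) i = \sum_(k < \dim {:V}) coords v k * N_ k.
  rewrite (linear_of_coords N) coords_sum; apply: eq_bigr => k _.
  by rewrite coordsZ.
have -> : restrict_line (M x) (M b) (Defs.pcomp f i)
    = \sum_(k < \dim {:V}) N_ k *: restrict_line x b (Defs.pcomp f k).
  apply/eqP; rewrite -subr_eq0; apply/eqP; apply: horner0_eq0 => t.
  rewrite hornerD hornerN horner_restrict_line horner_sum.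
  rewrite -linearZ -linearD -coords_polymap fMN NE.
  apply/eqP; rewrite subr_eq0; apply/eqP; apply: eq_bigr => k _.
  by rewrite hornerZ horner_restrict_line coords_polymap mulrC.
rewrite NE raddf_sum horner_sum; apply: eq_bigr => k _.
by rewrite /= derivZ hornerZ deriv_restrict_line coords_jacobian_map mulrC.
Qed.

End Equivariance.

(** * Regular functions and tangent vectors *)

Section RegularFunctions.
Variables (R : realType) (m : nat).

(* Coordinates of matrices refer to an arbitrary basis of 'M_m, so that even an
   entry is only a linear form in them. *)
Lemma peval_det : exists p : polyfun 'M[R[i]]_m, forall g, peval p g = \det g.
Proof.
have entry i j : exists p : polyfun 'M[R[i]]_m, forall g, peval p g = g i j.
  exists (\sum_(k < \dim {:'M[R[i]]_m}) (vbasis {:'M[R[i]]_m})`_k i j *: 'X_k) => g.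
  rewrite /peval raddf_sum -[RHS](congr1 (fun h : 'M_m => h i j) (of_coordsK g)).
  rewrite /of_coords summxE; apply: eq_bigr => k _.
  by rewrite /= mevalZ mevalXU mxE mulrC.
have [P PE] := choice (fun ij : 'I_m * 'I_m => entry ij.1 ij.2).
exists (\sum_(s : 'S_m) (-1) ^+ s * \prod_i P (i, s i)) => g.
rewrite /peval raddf_sum; apply: eq_bigr => s _ /=.
rewrite rmorphM rmorph_sign rmorph_prod; congr (_ * _).
by apply: eq_bigr => i _; apply: (PE (i, s i)).
Qed.

Variables (G : set 'M[R[i]]_m).
Hypothesis unitG : forall g, G g -> g \in unitmx.

Lemma regular_const c : regular G (fun=> c).
Proof.
by exists c%:MP, 0%N => g _; rewrite /peval mevalC expr0 divr1.
Qed.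

Lemma regularD a b : regular G a -> regular G b -> regular G (fun h => a h + b h).
Proof.
have [D DE] := peval_det.
move=> [p [e ae]] [q [k bk]]; exists (p * D ^+ k + q * D ^+ e), (e + k)%N => g Gg.
have := unitG Gg; rewrite unitmxE unitfE => det0.
rewrite ae // bk // /peval mevalD !mevalM !rmorphXn /=.
rewrite -!/(peval _ g) DE exprD.
by field; rewrite !expf_neq0.
Qed.

Lemma regularM a b : regular G a -> regular G b -> regular G (fun h => a h * b h).
Proof.
move=> [p [e ae]] [q [k bk]]; exists (p * q), (e + k)%N => g Gg.
by rewrite ae // bk // /peval mevalM exprD invfM mulrACA.
Qed.

Lemma regular_sum (J : Type) (r : seq J) (a : J -> 'M[R[i]]_m -> R[i]) :
  (forall j, regular G (a j)) -> regular G (fun h => \sum_(j <- r) a j h).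
Proof.
move=> ra; elim: r => [|j r IHr].
  have -> : (fun h => \sum_(j <- [::]) a j h) = (fun=> 0).
    by apply/funext => h; rewrite big_nil.
  exact: regular_const.
have -> : (fun h => \sum_(i <- j :: r) a i h)
    = (fun h => a j h + \sum_(i <- r) a i h).
  by apply/funext => h; rewrite big_cons.
exact: regularD.
Qed.

Lemma regular_meval n (a : 'M[R[i]]_m -> 'I_n -> R[i]) :
  (forall j, regular G (a^~ j)) -> forall p, regular G (fun h => p.@[a h]).
Proof.
move=> ra; elim/mpoly_ring_ind => [c|j|p q rp rq|p q rp rq].
- have -> : (fun h => c%:MP.@[a h]) = (fun=> c) by apply/funext => h; rewrite mevalC.
  exact: regular_const.
- have -> // : (fun h => ('X_j).@[a h]) = a^~ j.
  by apply/funext => h; rewrite mevalXU.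
- have -> : (fun h => (p + q).@[a h]) = (fun h => p.@[a h] + q.@[a h]).
    by apply/funext => h; rewrite mevalD.
  exact: regularD.
have -> : (fun h => (p * q).@[a h]) = (fun h => p.@[a h] * q.@[a h]).
  by apply/funext => h; rewrite mevalM.
exact: regularM.
Qed.

Section Tangent.
Variables (g : 'M[R[i]]_m) (delta : ('M[R[i]]_m -> R[i]) -> R[i]).
Hypothesis tan : tangent_vector G g delta.

Lemma tangentD a b : regular G a -> regular G b ->
  delta (fun h => a h + b h) = delta a + delta b.
Proof.
move=> ra rb; have := tangent_linear tan 1 ra rb; rewrite mul1r => <-.
by congr delta; apply/funext => h; rewrite mul1r.
Qed.

Lemma tangent_const c : delta (fun=> c) = 0.
Proof.
have r0 := regular_const 0; have r1 := regular_const 1.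
have d1 : delta (fun=> 1) = 0.
  have := tangent_leibniz tan r1 r1; rewrite !(mulr1, mul1r) => d11.
  by apply: (addrI (delta (fun=> 1))); rewrite addr0 -d11.
have d0 : delta (fun=> 0) = 0.
  by have := tangent_leibniz tan r0 r0; rewrite !mulr0 mul0r addr0.
by have := tangent_linear tan c r1 r0; rewrite d1 d0 !(mulr0, addr0, mulr1).
Qed.

Lemma tangent_sum (J : Type) (r : seq J) (a : J -> 'M[R[i]]_m -> R[i])
    (c : J -> R[i]) : (forall j, regular G (a j)) ->
  delta (fun h => \sum_(j <- r) a j h * c j) = \sum_(j <- r) delta (a j) * c j.
Proof.
move=> ra.
have rac j : regular G (fun h => a j h * c j).
  exact: regularM (ra j) (regular_const (c j)).
elim: r => [|j r IHr].
  rewrite big_nil -[RHS](tangent_const 0); congr delta.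
  by apply/funext => h; rewrite big_nil.
rewrite big_cons -IHr.
have -> : delta (a j) * c j = delta (fun h => a j h * c j).
  rewrite (tangent_leibniz tan (ra j) (regular_const (c j))) tangent_const.
  by rewrite mulr0 addr0.
rewrite -tangentD //; last exact: regular_sum.
by congr delta; apply/funext => h; rewrite big_cons.
Qed.

Lemma tangent_meval n (a : 'M[R[i]]_m -> 'I_n -> R[i]) p :
  (forall j, regular G (a^~ j)) ->
  delta (fun h => p.@[a h]) = \sum_j p^`M(j).@[a g] * delta (a^~ j).
Proof.
move=> ra; have rp := regular_meval ra.
rewrite (@derivation_mpoly _ _ _ (meval (a g)) (fun p => delta (fun h => p.@[a h]))).
- apply: eq_bigr => j _; congr (_ * delta _).
  by apply/funext => h; rewrite mevalXU.
- move=> q r; rewrite -tangentD //; congr delta.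
  by apply/funext => h; rewrite mevalD.
- move=> q r; have := tangent_leibniz tan (rp q) (rp r).
  rewrite [RHS]addrC [_ * r.@[_]]mulrC => <-; congr delta.
  by apply/funext => h; rewrite mevalM.
move=> c; rewrite -[RHS](tangent_const c); congr delta.
by apply/funext => h; rewrite mevalC.
Qed.

(** Evaluation at [v] followed by a coordinate is a linear form on ['End(V)], and [delta] commutes
    with linear forms. *)
Lemma differential_apply (V : vectType R[i]) (rho : 'M[R[i]]_m -> 'End(V)) v j :
  regular_map G rho ->
  coords (differential rho delta v) j = delta (fun h => coords (rho h v) j).
Proof.
move=> rrho; rewrite /differential /of_coords sum_lfunE coords_sum.
pose c (i : 'I_(\dim {:'End(V)})) := coords ((vbasis {:'End(V)})`_i v) j.
transitivity (\sum_i delta (fun h => coords (rho h) i) * c i).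
  by apply: eq_bigr => i _; rewrite scale_lfunE coordsZ.
rewrite -tangent_sum //; congr delta; apply/funext => h.
rewrite -[in RHS](of_coordsK (rho h)) sum_lfunE coords_sum.
by apply: eq_bigr => i _; rewrite scale_lfunE coordsZ.
Qed.

End Tangent.

Lemma regular_coords_apply (V : vectType R[i]) (rho : 'M[R[i]]_m -> 'End(V)) v j :
  regular_map G rho -> regular G (fun h => coords (rho h v) j).
Proof.
move=> rrho; pose c (i : 'I_(\dim {:'End(V)})) := coords ((vbasis {:'End(V)})`_i v) j.
have -> : (fun h => coords (rho h v) j) = (fun h => \sum_i coords (rho h) i * c i).
  apply/funext => h; rewrite -[in LHS](of_coordsK (rho h)) sum_lfunE coords_sum.
  by apply: eq_bigr => i _; rewrite scale_lfunE coordsZ.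
by apply: regular_sum => i; apply: regularM (rrho i) (regular_const _).
Qed.

End RegularFunctions.

(** * Rank of the derivative from algebraic independence *)

Lemma jacobian_rank (R : realType) (W V : vectType R[i]) (f : polymap W V)
    (S : set W) (n : nat) (p : 'I_n -> polyfun V) :
  independent_on (f @` S) p -> exists2 s, S s & (n <= \dim (limg (derivative f s)))%N.
Proof.
move=> indp.
(* The pullbacks by [f] of the [p i] are independent on [S] because the [p i] are so on its image;
   the Jacobian criterion will be applied to them. *)
pose pf F : polyfun W := mmap (@mpolyC _ _) (Defs.pcomp f) F.
have pfE F w : peval (pf F) w = peval F (f w).
  by rewrite /peval meval_mmap; apply: meval_eq => k; rewrite coords_polymap.
have dpf F j w : peval (pf F)^`M(j) w
    = \sum_k peval F^`M(k) (f w) * peval (Defs.pcomp f k)^`M(j) w.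
  rewrite (@derivation_mpoly _ _ _ (meval (coords (f w)))
             (fun F => peval (pf F)^`M(j) w)).
  - by apply: eq_bigr => k _; rewrite /pf mmapX mmap1U.
  - by move=> F1 F2; rewrite /pf rmorphD mderivD /peval mevalD.
  - move=> F1 F2; have -> : pf (F1 * F2) = pf F1 * pf F2 by rewrite /pf rmorphM.
    move: (pf F1) (pf F2) (pfE F1 w) (pfE F2 w) => a b aE bE.
    rewrite mderivM /peval mevalD !mevalM addrC.
    by move: aE bE; rewrite /peval => -> ->.
  by move=> c; rewrite /pf mmapC mderivC /peval meval0.
pose T : pointedType := HB.pack W (isPointed.Build W 0).
have [s Ss [C]] : exists2 s, S s & exists C : 'M_(\dim {:W}, n),
    (\matrix_(i < n, j < \dim {:W}) (pf (p i))^`M(j).@[coords s]) *m C = 1%:M.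
  apply: (@jacobian_criterion _ T S _ _ (@coords R W) (fun i => pf (p i))).
  move=> F F0; apply: indp => _ [s Ss <-]; rewrite -[RHS](F0 s Ss).
  by apply: meval_eq => i; rewrite -pfE.
move=> JC; exists s => //.
(* The columns of [C], pushed forward by the derivative of [f]. By the chain rule [dpf], the
   differentials of the [p i] at [f s] are dual to the [v k], which are therefore linearly
   independent. *)
pose v (k : 'I_n) := jacobian_map f s (of_coords (fun j => C j k)).
have vE i k : \sum_l peval (p i)^`M(l) (f s) * coords (v k) l = (i == k)%:R.
  have /matrixP/(_ i k) := JC; rewrite !mxE => <-.
  transitivity (\sum_j \sum_l peval (p i)^`M(l) (f s) *
      peval (Defs.pcomp f l)^`M(j) s * C j k); last first.
    apply: eq_bigr => j _; rewrite mxE -[_.@[_]]/(peval _ _) dpf mulr_suml.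
    by [].
  rewrite exchange_big; apply: eq_bigr => l _ /=.
  rewrite coords_jacobian_map mulr_sumr; apply: eq_bigr => j _.
  by rewrite coords_of_coords mulrA.
pose X := [tuple v k | k < n].
have XE (k : 'I_n) : X`_k = v k by rewrite (nth_map k) ?size_enum_ord // nth_ord_enum.
have freeX : free X.
  apply/freeP => c c0 k.
  have := congr1 (fun x => \sum_l peval (p k)^`M(l) (f s) * coords x l) c0.
  rewrite [RHS]big1 => [|l _]; last by rewrite /coords linear0 mulr0.
  under eq_bigr do rewrite coords_sum mulr_sumr.
  rewrite exchange_big /= (bigD1 k) //= [X in _ + X]big1 => [|i neik].
    rewrite addr0; under eq_bigr do rewrite XE coordsZ mulrCA.
    by rewrite -mulr_sumr vE eqxx mulr1.
  under eq_bigr do rewrite XE coordsZ mulrCA.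
  by rewrite -mulr_sumr vE eq_sym (negPf neik) mulr0.
have /eqP <- : \dim <<X>> == n by move: freeX; rewrite /free size_tuple.
apply: dimvS; apply/span_subvP => x /mapP[k _ ->].
by rewrite -[v k](lfunE (jacobian_map f s)) memv_img ?memvf.
Qed.

(** * Derivatives of equivariant maps along an orbit *)

Section EquivariantMap.
Variables (R : realType) (m : nat) (G : set 'M[R[i]]_m).
Hypothesis hG : linear_algebraic_group G.
Variables (W V : vectType R[i]).
Variables (sigma : 'M[R[i]]_m -> 'End(W)) (rho : 'M[R[i]]_m -> 'End(V)).
Hypothesis hsigma : algebraic_representation G sigma.
Hypothesis hrho : algebraic_representation G rho.
Variable f : polymap W V.
Hypothesis hf : forall g, G g -> forall w, f (sigma g w) = rho g (f w).

Lemma repK (E : vectType R[i]) (tau : 'M[R[i]]_m -> 'End(E)) g x :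
  algebraic_representation G tau -> G g -> tau (invmx g) (tau g x) = x.
Proof.
move=> htau Gg; rewrite -comp_lfunE -(rep_mul htau) //; last exact: lag_inv.
by rewrite mulVmx ?(lag_unit hG) // (rep_one htau) id_lfunE.
Qed.

Lemma repVK (E : vectType R[i]) (tau : 'M[R[i]]_m -> 'End(E)) g x :
  algebraic_representation G tau -> G g -> tau g (tau (invmx g) x) = x.
Proof.
by move=> htau Gg; rewrite -{1}[g]invmxK repK //; apply: lag_inv.
Qed.

Lemma differential_in_image g delta w : G g -> tangent_vector G g delta ->
  exists b, differential rho delta (f w) = jacobian_map f (sigma g w) b.
Proof.
move=> Gg tan; have unitG := lag_unit hG.
(* The witness is the derivative along [delta] of the orbit map of [w], so the chain rule turns the
   right-hand side into the derivative of [f] composed with this map. *)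
exists (of_coords (fun j => delta (fun h => coords (sigma h w) j))).
apply: coords_inj => i; rewrite (differential_apply unitG tan _ _ (rep_regular hrho)).
have rsigma j := regular_coords_apply unitG w j (rep_regular hsigma).
rewrite coords_jacobian_map.
under eq_bigr do rewrite coords_of_coords.
rewrite -[RHS](tangent_meval unitG tan (Defs.pcomp f i) rsigma).
(* Equivariance makes the two functions agree only on [G], which is all that [tangent_ext] asks. *)
apply: (tangent_ext tan) => [||h Gh].
- exact: regular_coords_apply (rep_regular hrho).
- exact: regular_meval.
- by rewrite -hf // coords_polymap.
Qed.

(** As [sigma h] is onto, equivariance places the image at [sigma h w] inside the [rho h]-image of
    the one at [w], and a linear map does not raise dimensions. *)
Lemma derivative_orbit_dim w h : G h ->
  (\dim (limg (derivative f (sigma h w))) <= \dim (limg (derivative f w)))%N.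
Proof.
move=> Gh; apply: (@leq_trans (\dim (rho h @: limg (derivative f w)))).
  apply: dimvS; apply/subvP => _ /memv_imgP[b _ ->].
  rewrite -[b](repVK _ hsigma Gh) lfunE /= (equivariant_jacobian_map (hf Gh)).
  by rewrite memv_img // -[jacobian_map _ _ _](lfunE (jacobian_map f w)) memv_img ?memvf.
by rewrite -(limg_ker_dim (rho h) (limg _)) leq_addl.
Qed.

End EquivariantMap.

Theorem proposition7p6 (R : realType) (m : nat) (G : set 'M[R[i]]_m)
    (hG : linear_algebraic_group G)
    (W V : vectType R[i])
    (sigma : 'M[R[i]]_m -> 'End(W)) (hsigma : algebraic_representation G sigma)
    (rho : 'M[R[i]]_m -> 'End(V)) (hrho : algebraic_representation G rho)
    (f : polymap W V)
    (hf : forall g, G g -> forall w, f (sigma g w) = rho g (f w))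
    (w : W) (g : 'M[R[i]]_m) (hg : G g) :
  [set rho (invmx g) (A (f w)) | A in im_differential G rho g]
    `<=` [set` limg (derivative f w)] /\
  (zariski_dim [set rho h (f w) | h in G]
    <= (\dim (limg (derivative f w)))%:R%:E)%E.
Proof.
split=> [_ [_ [delta tan <-] <-]|].
  have [b ->] := differential_in_image hG hsigma hrho hf w hg tan.
  (* Applying [rho (invmx g)] brings the image at [sigma g w] back to the image at [w]. *)
  have Gg' := lag_inv hG hg.
  rewrite -(equivariant_jacobian_map (hf _ Gg')) (repK hG _ hsigma hg) /=.
  by rewrite -[jacobian_map _ _ _](lfunE (jacobian_map f w)) memv_img ?memvf.
(* The dimension is a supremum over chains, so it suffices to bound the length of each. *)
apply: ge_ereal_sup => _ [n [Z chainZ] <-].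
rewrite lee_fin ler_nat.
have [p indp] := chain_independent chainZ.
have [irrZ _] := chainZ; have [_ [A _ ZE]] := irrZ n (leqnn n).
(* [Z n] lies in the orbit of [f w], which is the image under [f] of the orbit of [w]; independence
   on [Z n] thus passes to that larger set. *)
have [|s [h Gh <-] le_n] := @jacobian_rank _ _ _ f [set sigma h w | h in G] n p.
  move=> F F0; apply: indp => z; rewrite ZE => -[[h Gh <-] _].
  by apply: F0; exists (sigma h w); [exists h|rewrite hf].
exact: leq_trans le_n (derivative_orbit_dim hG hsigma hf w Gh).
Qed.
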